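(* Let $X$ be a compact doubling metric space and let $\mu$ be an Ahlfors regular measure on $X$ (with some index $s$). Then $\mu$ is a box-counting measure of $X$; that is, $\dim_B X$ exists and there is a compact Vitalli-type covering $\mathcal F$ of $X$ such that $\mu$ is an $\mathcal F$-box-counting measure.
   Context: Let $(X,d_X)$ be a compact metric space; $B(x,r)$ denotes the (open) ball in $X$ with center $x$ and radius $r$. For $A\subset X$ and $\delta>0$, a family of balls of $X$ of radius $\delta$ is a $\delta$-ball-packing of $A$ if the balls are pairwise disjoint and their centers lie in $A$. $\mathcal N_\delta(A)$ is the maximal cardinality of a $\delta$-ball-packing of $A$. The box dimension is $\dim_B X=\lim_{\delta\to0}\frac{\log \mathcal N_\delta(X)}{-\log\delta}$, when this limit exists. Compact Vitalli-type covering: a sequence $\mathcal F=\{\mathcal F_k\}_{k\ge1}$ where each $\mathcal F_k$ is a covering of $X$ by subsets of $X$, such that (i) every element of $\mathcal F_k$ is compact; (ii) there is an integer $\lambda$ such that for all $k\ge1$ every point $x\in X$ is covered by at most $\lambda$ elements of $\mathcal F_k$; (iii) $\max\{\operatorname{diam}A: A\in\mathcal F_k\}\to0$ as $k\to\infty$. Box-counting measure: suppose $\beta=\dim_B X$ exists, let $\mu$ be a finite Borel measure on $X$ and $\mathcal F$ a compact Vitalli-type covering of $X$. $\mu$ is an $\mathcal F$-box-counting measure if there is a constant $M>0$ such that for every $R\in\bigcup_{k\ge1}\mathcal F_k$ there is $\delta_0(R)>0$ with $$M^{-1}\mu(R)\le \mathcal N_\delta(R)\,\delta^{\beta}\le M\mu(R)\qquad\text{for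 all }0<\delta\le\delta_0(R).$$ $\mu$ is a box-counting measure of $X$ if it is an $\mathcal F$-box-counting measure for some compact Vitalli-type covering $\mathcal F$. A metric space $X$ is doubling if there is a constant $C>0$ such that for all $x\in X$, $r>0$, the ball $B(x,2r)$ can be covered by $C$ balls of radius $r$. A (Borel) measure $\mu$ on $X$ is Ahlfors regular with index $s$ if there is $C>0$ such that $C^{-1}r^s\le\mu(B(x,r))\le Cr^s$ for all $x\in X$ and $r\in(0,1)$. *)

(* Defs.v *)
From HB Require Import structures.
From mathcomp Require Import all_boot all_order all_algebra finmap.
From mathcomp Require Import all_classical all_reals all_analysis.

Set Implicit Arguments.
Unset Strict Implicit.
Unset Printing Implicit Defensive.

Import Order.TTheory GRing.Theory Num.Theory.
Import numFieldNormedType.Exports.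

Local Open Scope classical_set_scope.
Local Open Scope ring_scope.

(* Nonempty metric spaces: [measurableType], hence a measure, requires a
   pointed carrier. The distinguished point is never used below. *)
#[short(type="pmetricType")]
HB.structure Definition PointedMetric (K : numDomainType) :=
  {M of Pointed M & Metric K M}.

Notation borel_space X := (g_sigma_algebraType (@open X)).

Section BoxCounting.
Context {R : realType}.

Section MetricNotions.
Context {X : pmetricType R}.
Implicit Types (A : set X) (F : nat -> set (set X)).

(* A packing by balls of radius [delta > 0] is identified with its set [S] of
   centers: as balls are nonempty, disjoint ones have distinct centers. *)
Definition ball_packing (delta : R) A (S : set X) : Prop :=
  S `<=` A /\ trivIset S (fun x => ball x delta).

(* Extended-real valued, so that unbounded packings give [+oo] and not a
   default value. *)
Definition packing_number (delta : R) A : \bar R :=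
  ereal_sup [set (#|` S|%fset%:R)%:E |
    S in [set S : {fset X} | ball_packing delta A [set` S]]].

(* The point [0] only serves to set the diameter of the empty set to [0]. *)
Definition diam A : \bar R :=
  ereal_sup (0%E |` [set (mdist p.1 p.2)%:E | p in A `*` A]).

Definition is_max (E : set (\bar R)) (m : \bar R) : Prop :=
  E m /\ ubound E m.

(* The sequence is indexed by [k >= 1]; the value [F 0] is irrelevant. *)
Definition compact_vitali_covering F : Prop :=
  [/\ forall k, (1 <= k)%N -> \bigcup_(A in F k) A = [set: X],
      forall k, (1 <= k)%N -> forall A, F k A -> compact A,
      exists lambda : nat, forall k, (1 <= k)%N -> forall x : X,
        ([set A | F k A /\ A x] #<= `I_lambda)%card
    & exists m : nat -> \bar R,
        (forall k, (1 <= k)%N -> is_max (diam @` F k) (m k)) /\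
        m @ \oo --> 0%E].

End MetricNotions.

Section SpaceNotions.
Variable X : pmetricType R.

Definition has_box_dim (beta : R) : Prop :=
  (lne (packing_number delta [set: X]) / (- ln delta)%:E)%E
    @[delta --> 0^'+] --> beta%:E.

Definition doubling : Prop :=
  exists C : nat, (0 < C)%N /\
    forall (x : X) (r : R), 0 < r ->
      exists c : 'I_C -> X, ball x (2 * r) `<=` \bigcup_i ball (c i) r.

End SpaceNotions.

Section MeasureNotions.
Context {X : pmetricType R}.
Variable mu : {measure set (borel_space X) -> \bar R}.

Definition box_counting_for (beta : R) (F : nat -> set (set X)) : Prop :=
  exists M : R, 0 < M /\
    forall k, (1 <= k)%N -> forall A, F k A ->
      exists delta0 : R, 0 < delta0 /\
        forall delta : R, 0 < delta <= delta0 ->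
          ((M^-1)%:E * mu A <= packing_number delta A * (delta `^ beta)%:E /\
           packing_number delta A * (delta `^ beta)%:E <= M%:E * mu A)%E.

Definition box_counting_measure : Prop :=
  (mu [set: X] < +oo)%E /\
  exists beta : R, has_box_dim X beta /\
    exists F, compact_vitali_covering F /\ box_counting_for beta F.

Definition ahlfors_regular (s : R) : Prop :=
  exists C : R, 0 < C /\
    forall (x : X) (r : R), 0 < r < 1 ->
      ((C^-1 * r `^ s)%:E <= mu (ball x r) <= (C * r `^ s)%:E)%E.

End MeasureNotions.

End BoxCounting.

(* Main.v *)
(* Disjoint balls of radius d centred in A lie in the d-neighbourhood of A, and
   doubling the radii of a maximal packing of A covers A. Ahlfors regularity
   turns this into
     mu A / (2^s C) <= N_d(A) d^s <= C mu (d-neighbourhood of A),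
   which for A = X gives dim_B X = s. When A is a closed ball, mu A > 0 and the
   measure of its d-neighbourhood tends to mu A, so it is eventually at most
   2 mu A. The covering F_k consists of closed balls of radius 2/(k + 8) centred
   at a maximal 1/(k + 8)-packing; comparing the measures of the disjoint balls
   of radius e = 1/(k + 8) inside B(y, 4e) shows that at most 4^s C^2 elements
   of F_k contain a given point y. The shift by 8 keeps all radii below 1, the
   range of the regularity hypothesis. *)
Require Import Defs.
From mathcomp Require Import all_boot all_order all_algebra finmap.
From mathcomp Require Import all_classical all_reals all_analysis.
From mathcomp Require Import ring lra.

Import Order.TTheory GRing.Theory Num.Theory.
Import numFieldNormedType.Exports.

Local Open Scope classical_set_scope.
Local Open Scope ring_scope.

(** Provides the attained maximal diameter required by [compact_vitali_covering]: each covering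
    below is indexed by a finite packing. *)
Lemma finite_is_max (R : realType) (I : choiceType) (S : {fset I})
    (f : I -> \bar R) :
  [set` S] !=set0 -> exists m, is_max (f @` [set` S]) m.
Proof.
move=> [x0 Sx0].
case: (@arg_maxP _ _ S [` Sx0]%fset xpredT (fun y : S => f (val y)) isT).
move=> i _ im.
exists (f (val i)); split; first by exists (val i) => //; exact: valP.
by move=> _ [x Sx <-]; exact: (im [` Sx]%fset).
Qed.

(** * Topology, measurability and diameter of balls *)

Section MetricBalls.
Context {R : realType} {X : pmetricType R}.
Implicit Types (x : X) (A : set X) (r : R).

Definition cball x r : set X := [set y | mdist x y <= r].

Lemma open_mball x r : open (ball x r).
Proof.
rewrite openE => y; rewrite ballEmdist /= => xy.
rewrite /interior -nbhs_ballE; exists (r - mdist x y); rewrite /= ?subr_gt0//.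
move=> z; rewrite ballEmdist /= ltrBrDl.
exact/le_lt_trans/metric_triangle.
Qed.

Lemma ball_sub_cball x r : ball x r `<=` cball x r.
Proof. by move=> y; rewrite ballEmdist => /ltW. Qed.

Lemma closed_cball x r : closed (cball x r).
Proof.
rewrite -openC openE => y /= /negP; rewrite -ltNge => xy.
rewrite /interior -nbhs_ballE; exists (mdist x y - r); rewrite /= ?subr_gt0//.
move=> z; rewrite ballEmdist /= => yz; apply/negP; rewrite -ltNge.
by have := metric_triangle x z y; rewrite (metric_sym z y); lra.
Qed.

(** This form serves twice: for the measurability of closed balls, and for continuity from above of
    the measure along shrinking open neighbourhoods. *)
Lemma cball_bigcap x r : cball x r = \bigcap_n ball x (r + n.+1%:R^-1).
Proof.
apply/seteqP; split => y.
  move=> xy n _; rewrite ballEmdist /=.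
  by apply: le_lt_trans xy _; rewrite ltrDl.
move=> xy; rewrite /cball /= leNgt; apply/negP => /ltr_add_invr[n].
by have := xy n I; rewrite ballEmdist /= => /lt_trans h /h; rewrite ltxx.
Qed.

Lemma measurable_ball x r : measurable (ball x r : set (borel_space X)).
Proof. by apply: sub_sigma_algebra; exact: open_mball. Qed.

Lemma measurable_cball x r : measurable (cball x r : set (borel_space X)).
Proof.
rewrite cball_bigcap; apply: bigcap_measurable => // n _.
exact: measurable_ball.
Qed.

Lemma diam_ge0 A : (0 <= diam A)%E.
Proof. by apply: ereal_sup_ubound; left. Qed.

Lemma diam_cball x r : 0 <= r -> (diam (cball x r) <= (2 * r)%:E)%E.
Proof.
move=> r0; apply: ge_ereal_sup => _ [->|[[y z] [/= xy xz] <-]].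
  by rewrite lee_fin mulr_ge0.
rewrite lee_fin; move: xy xz; rewrite /cball /=.
by have := metric_triangle y x z; rewrite (metric_sym y x); lra.
Qed.

End MetricBalls.

(** * Box dimension from two-sided packing bounds *)

Section BoxDimension.
Context {R : realType} {X : pmetricType R}.

(** Taking logarithms and dividing by [- ln d > 0] squeezes the quotient between [s + ln a / - ln d]
    and [s + ln b / - ln d], and both tend to [s]. *)
Lemma has_box_dim_bounds (a b s : R) : 0 < a ->
  (forall d : R, 0 < d < 2^-1 -> exists v : R,
    [/\ packing_number d [set: X] = v%:E, a <= v * d `^ s & v * d `^ s <= b]) ->
  has_box_dim X s.
Proof.
move=> a0 H.
have ab : a <= b by have [|v [_ /le_trans h /h]] := H 4^-1; first lra.
have b0 : 0 < b := lt_le_trans a0 ab.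
have lim c : (s + ln c * (- ln d)^-1)%:E @[d --> 0^'+] --> s%:E.
  apply: cvg_EFin; first exact: nearW.
  suff : s + ln c * (- ln d)^-1 @[d --> 0^'+] --> s + ln c * 0.
    by rewrite mulr0 addr0.
  apply: cvgD; first exact: cvg_cst.
  apply: cvgM; first exact: cvg_cst.
  apply/gtr0_cvgV0; last exact: (proj2 (cvgNry _) (@lnNy R)).
  near=> d; rewrite oppr_gt0 ln_lt0//; apply/andP; split; near: d.
    exact: nbhs_right_gt.
  exact: nbhs_right_lt.
apply: squeeze_cvge (lim a) (lim b).
near=> d.
have d0 : 0 < d by near: d; exact: nbhs_right_gt.
have d1 : d < 2^-1 by near: d; exact: nbhs_right_lt.
have [|v [-> av vb]] := H d; first by rewrite d0.
have l0 : 0 < - ln d by rewrite oppr_gt0 ln_lt0// d0/=; lra.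
have ds0 : 0 < d `^ s by exact: powR_gt0.
have v0 : 0 < v by rewrite -(pmulr_lgt0 _ ds0); exact: lt_le_trans av.
rewrite lne_EFin// inver gt_eqF// -EFinM !lee_fin.
have e t : s + t * (- ln d)^-1 = (t - s * ln d) * (- ln d)^-1.
  by field; rewrite -oppr_eq0 gt_eqF.
rewrite !e !ler_pM2r ?invr_gt0// lerBlDr lerBrDr -ln_powR -lnM ?posrE//.
by rewrite !ler_ln ?posrE ?mulr_gt0// av.
Unshelve. all: by end_near. Qed.

End BoxDimension.

(** * Measures of balls and packings under Ahlfors regularity *)

Section Regular.
Context {R : realType} {X : pmetricType R}.
Variable mu : {measure set (borel_space X) -> \bar R}.
Context (C s : R) (C0 : 0 < C).
Hypothesis reg : forall (x : X) (r : R), 0 < r < 1 ->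
  ((C^-1 * r `^ s)%:E <= mu (ball x r) <= (C * r `^ s)%:E)%E.

(** Finitely many balls of radius [2^-1] cover the space, and regularity bounds each of them. *)
Lemma regular_finite : compact [set: X] -> (mu [set: X] < +oo)%E.
Proof.
rewrite compact_cover => /(_ _ setT (fun x => ball x 2^-1))[].
- by move=> x _; exact: open_mball.
- by move=> x _; exists x => //; exact: ballxx.
move=> D _ cov.
have := @content_sub_fsum _ _ _ mu X [set` D] setT (fun x => ball x 2^-1).
move=> /(_ (finite_fset _) (fun x _ => measurable_ball x _) measurableT cov).
move=> /le_lt_trans; apply.
rewrite -fsbig_seq//; apply: lte_sum_pinfty => x _.
have /andP[_ h] := reg x (2^-1) ltac:(lra).
exact: le_lt_trans h (ltry _).
Qed.

(** [U] is left free: it will be the whole space, a neighbourhood of a closed ball, or a ball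
    containing all the packed balls near a point. *)
Lemma packing_le_measure (d : R) (A : set X) (S : {fset X})
    (U : set X) :
  0 < d < 1 ->
  ball_packing d A [set` S] -> measurable (U : set (borel_space X)) ->
  (forall x, A x -> ball x d `<=` U) ->
  ((#|` S|%fset%:R * (C^-1 * d `^ s))%:E <= mu U)%E.
Proof.
move=> d01 [SA tS] mU AU.
have mb x : x \in S -> measurable (ball x d : set (borel_space X)).
  by move=> _; exact: measurable_ball.
apply: (@le_trans _ _ (mu (\big[setU/set0]_(x <- S) ball x d))); last first.
  apply: le_measure; rewrite ?inE//.
    by rewrite -bigcup_fset; apply: fin_bigcup_measurable.
  by rewrite -bigcup_fset => y [x Sx]; apply: AU; exact: SA.
rewrite (@measure_fbigsetU _ _ _ mu X S (fun x => ball x d))//.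
rewrite mulr_natl card_fset_sum1.
rewrite -sumrMnr -sumEFin; apply: lee_sum => x _.
by have /andP[] := reg x d d01.
Qed.

Lemma measure_ball_gt0 (x : X) (r : R) : 0 < r -> (0 < mu (ball x r))%E.
Proof.
(* Shrinking the radius below 1 makes regularity applicable. *)
move=> r0; pose t := Num.min r 2^-1.
have t0 : 0 < t < 1.
  rewrite lt_min gt_min r0 /=; apply/andP; split; last (apply/orP; right); lra.
have /andP[h _] := reg x t t0.
apply: lt_le_trans (le_trans h _).
  by rewrite lte_fin mulr_gt0 ?invr_gt0// powR_gt0; case/andP: t0.
apply: le_measure; rewrite ?inE; try exact: measurable_ball.
by apply: le_ball; rewrite ge_min lexx.
Qed.

Lemma measure_setT_gt0 : (0 < mu [set: X])%E.
Proof.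
apply: (lt_le_trans (@measure_ball_gt0 point 1 ltr01)).
by apply: le_measure; rewrite ?inE//; exact: measurable_ball.
Qed.

(** * Maximal packings and bounds on packing numbers *)

Hypothesis cptX : compact [set: X].

(** Each packed ball has measure at least C^-1 d^s, so finiteness of [mu] bounds the size of
    packings and one of maximal size exists. *)
Lemma ball_packing_max (d : R) (A : set X) : 0 < d < 1 -> exists S : {fset X},
  [/\ ball_packing d A [set` S], packing_number d A = (#|` S|%fset%:R)%:E &
      A `<=` \bigcup_(x in [set` S]) ball x (2 * d)].
Proof.
move=> d01; have /andP[d0 d1] := d01.
have c0 : 0 < C^-1 * d `^ s by rewrite mulr_gt0 ?invr_gt0// powR_gt0.
have fmu : mu [set: X] \is a fin_num.
  by rewrite ge0_fin_numE//; exact: regular_finite.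
pose P n :=
  `[< exists2 S : {fset X}, ball_packing d A [set` S] & #|` S|%fset = n >].
have P0 : exists n, P n.
  exists 0%N; apply/asboolP; exists fset0; last exact: cardfs0.
  by split => // x.
have Pm n : P n -> (n <= Num.truncn (fine (mu [set: X]) / (C^-1 * d `^ s)))%N.
  move=> /asboolP[S pS <-]; rewrite truncn_ge_nat; last first.
    by rewrite divr_ge0 ?fine_ge0// ltW.
  rewrite ler_pdivlMr// -lee_fin fineK//.
  by apply: packing_le_measure pS _ _.
case: (ex_maxnP P0 Pm) => _ /asboolP[S pS <-] Smax.
exists S; split => //.
  apply/eqP; rewrite eq_le; apply/andP; split.
    apply: ge_ereal_sup => _ [T /= pT <-].
    by rewrite lee_fin ler_nat; apply: Smax; apply/asboolP; exists T.
  by apply: ereal_sup_ubound; exists S.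
move=> y Ay; apply: contrapT => Sy.
have far x : x \in S -> 2 * d <= mdist x y.
  move=> xS; rewrite leNgt; apply/negP => xy; apply: Sy; exists x => //.
  by rewrite ballEmdist.
have yS : y \notin S by apply/negP => /far; rewrite mdistxx; lra.
(* A point at distance at least [2 * d] from every centre could be added to the packing, against
   maximality. *)
suff /Smax : P #|` y |` S|%fset by rewrite cardfsU1 yS add1n ltnn.
apply/asboolP; exists (y |` S)%fset => //.
have [SA tS] := pS.
have disj x : x \in S -> ~ (ball x d `&` ball y d !=set0).
  move=> /far xy [z []]; rewrite !ballEmdist /= => xz yz.
  by have := metric_triangle x z y; rewrite (metric_sym z y); lra.
split=> [x|]; first by rewrite /= !inE => /orP[/eqP->//|/SA].
move=> x z; rewrite /= !inE => /orP[/eqP->|xS] /orP[/eqP->|zS]//.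
- by rewrite setIC => /(disj _ zS).
- by move=> /(disj _ xS).
- exact: tS.
Qed.

(** The doubled balls of a maximal packing cover [A]; [d < 2^-1] keeps their radius [2 * d] below
    1. *)
Lemma packing_number_lower (d : R) (A : set X) : 0 < d < 2^-1 ->
  measurable (A : set (borel_space X)) ->
  (mu A <= packing_number d A * (d `^ s)%:E * (C * 2 `^ s)%:E)%E.
Proof.
move=> d01 mA.
have [|S [pS -> cov]] := @ball_packing_max d A; first lra.
have := @content_sub_fsum _ _ _ mu X [set` S] A (fun x => ball x (2 * d)).
move=> /(_ (finite_fset _) (fun x _ => measurable_ball x _) mA cov).
move=> /le_trans; apply.
rewrite -fsbig_seq// -!EFinM -mulrA (mulr_natl (d `^ s * _)) card_fset_sum1.
rewrite -sumrMnr -sumEFin; apply: lee_sum => x _.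
have /andP[_] := reg x (2 * d) ltac:(lra).
by rewrite powRM//; [congr (_ <= _%:E)%E; ring|lra].
Qed.

Lemma packing_number_upper (d : R) (A : set X) (U : set X) : 0 < d < 1 ->
  measurable (U : set (borel_space X)) ->
  (forall x, A x -> ball x d `<=` U) ->
  (packing_number d A * (d `^ s)%:E <= C%:E * mu U)%E.
Proof.
move=> d01 mU AU.
have [S [pS -> _]] := @ball_packing_max d A d01.
have h := packing_le_measure _ _ _ _ d01 pS mU AU.
by rewrite -lee_pdivrMl// -!EFinM mulrCA.
Qed.

(** * Box dimension of the space and box counting on closed balls *)

Lemma regular_box_dim : has_box_dim X s.
Proof.
have fmu : mu [set: X] \is a fin_num.
  by rewrite ge0_fin_numE//; exact: regular_finite.
have m0 : 0 < fine (mu [set: X]).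
  by rewrite -lte_fin fineK// measure_setT_gt0.
have k0 : 0 < C * 2 `^ s by rewrite mulr_gt0// powR_gt0.
apply: (@has_box_dim_bounds _ _ (fine (mu [set: X]) / (C * 2 `^ s))
  (C * fine (mu [set: X])) s); first exact: divr_gt0.
move=> d d01; have d1 : 0 < d < 1 by lra.
have [S [_ pS _]] := @ball_packing_max d setT d1.
exists (#|` S|%fset%:R); split=> //.
  rewrite ler_pdivrMr// -lee_fin fineK// !EFinM -pS -EFinM.
  exact: packing_number_lower.
rewrite -lee_fin !EFinM -pS fineK//.
exact: packing_number_upper.
Qed.

(** The constant adds what the lower bound needs, C 2^s, to what the upper bound needs, 2 C. Only
    [d0] depends on the ball, so one constant serves the whole covering. *)
Lemma cball_box_counting (x : X) (r : R) : 0 < r -> exists d0 : R, 0 < d0 /\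
  forall d : R, 0 < d <= d0 ->
  (((C * 2 `^ s + 2 * C)^-1)%:E * mu (cball x r) <=
     packing_number d (cball x r) * (d `^ s)%:E /\
   packing_number d (cball x r) * (d `^ s)%:E <=
     (C * 2 `^ s + 2 * C)%:E * mu (cball x r))%E.
Proof.
move=> r0.
pose F n := ball x (r + n.+1%:R^-1).
have ltoo A : measurable (A : set (borel_space X)) -> (mu A < +oo)%E.
  move=> mA; apply: le_lt_trans (regular_finite cptX).
  by apply: le_measure; rewrite ?inE.
have mF n : measurable (F n : set (borel_space X)) by exact: measurable_ball.
have mcb := measurable_cball x r.
have fcb : mu (cball x r) \is a fin_num by rewrite ge0_fin_numE// ltoo.
have cb0 : 0 < fine (mu (cball x r)).
  rewrite -lte_fin fineK//; apply: (lt_le_trans (@measure_ball_gt0 x r r0)).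
  apply: le_measure; rewrite ?inE//; first exact: measurable_ball.
  exact: ball_sub_cball.
have cvgF : mu \o F @ \oo --> mu (cball x r).
  rewrite cball_bigcap; apply: nonincreasing_cvg_mu => //.
  - exact: ltoo.
  - by apply: bigcap_measurable.
  - move=> m n mn; apply/subsetPset; apply: le_ball.
    by rewrite lerD2l lef_pV2 ?posrE// ler_nat.
(* Since the closed ball has positive measure, twice that measure strictly exceeds the limit. *)
have [n _ /(_ n (leqnn n)) Fn] : \forall n \near \oo,
    fine (mu (F n)) < 2 * fine (mu (cball x r)).
  have /fine_cvg : mu \o F @ \oo --> (fine (mu (cball x r)))%:E.
    by rewrite fineK.
  by move=> /cvgr_lt; apply; lra.
(* The threshold [n.+4%:R^-1] is at most [n.+1%:R^-1], so that the [d]-neighbourhood lies in [F n],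
   and at most [4^-1], so that both packing bounds apply. *)
have n4 : n.+4%:R^-1 <= n.+1%:R^-1 :> R.
  by rewrite lef_pV2 ?posrE// ler_nat ltnS (leq_addl 3).
have n4' : n.+4%:R^-1 <= 4^-1 :> R by rewrite lef_pV2 ?posrE// ler_nat.
exists (n.+4%:R^-1); split => // d /andP[d0 dn].
have {n4'}d4 := le_trans dn n4'; have {n4 dn}dn := le_trans dn n4.
pose k := C * 2 `^ s; have k0 : 0 < k by rewrite mulr_gt0// powR_gt0.
rewrite -/k.
have pk0 : (0 <= packing_number d (cball x r) * (d `^ s)%:E)%E.
  rewrite mule_ge0 ?lee_fin ?powR_ge0//; apply: ereal_sup_ubound => /=.
  by exists fset0; [split => // y|rewrite cardfs0].
have upper : (packing_number d (cball x r) * (d `^ s)%:E <= C%:E * mu (F n))%E.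
  apply: packing_number_upper => //.
    by rewrite d0 (le_lt_trans d4)// invf_lt1 ?ltr1n.
  move=> y; rewrite /cball /F /= => xy z; rewrite !ballEmdist /= => yz.
  apply: le_lt_trans (metric_triangle x y z) _.
  exact: ler_ltD xy (lt_le_trans yz dn).
have M0 : 0 < k + 2 * C by rewrite addr_gt0// mulr_gt0.
clear dn; split.
  rewrite lee_pdivrMl//.
  rewrite muleC; apply: le_trans (@packing_number_lower d _ _ mcb) _; first lra.
  by apply: lee_wpmul2l; rewrite ?lee_fin ?lerDl// mulr_ge0// ltW.
apply: le_trans upper _.
rewrite -(fineK fcb) -(@fineK _ (mu (F n))) ?ge0_fin_numE ?ltoo//.
rewrite -!EFinM lee_fin.
apply: (@le_trans _ _ (C * (2 * fine (mu (cball x r))))).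
  by rewrite ler_pM2l// ltW.
by rewrite mulrA (mulrC C) ler_pM2r// lerDr ltW.
Qed.

(** * The Vitali-type covering by closed balls *)

Lemma regular_covering : exists F : nat -> set (set X),
  compact_vitali_covering F /\
  forall k, (1 <= k)%N -> forall A, F k A ->
  exists x r, 0 < r /\ A = cball x r.
Proof.
pose e k : R := (k + 8)%:R^-1.
have e0 k : 0 < e k by rewrite invr_gt0 ltr0n addn_gt0 orbT.
have e8 k : e k <= 8^-1.
  by rewrite lef_pV2 ?posrE ?ltr0n ?addn_gt0 ?orbT// ler_nat leq_addl.
have pack k : exists S : {fset X}, ball_packing (e k) setT [set` S] /\
    [set: X] `<=` \bigcup_(x in [set` S]) ball x (2 * e k).
  have [|S [? _ ?]] := @ball_packing_max (e k) setT; last by exists S.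
  by rewrite e0/=; have := e8 k; lra.
have {pack}[S /all_and2[pS cov]] := choice pack.
pose F k := (fun x => cball x (2 * e k)) @` [set` S k].
have Sne k : [set` S k] !=set0 by have [x Sx _] := cov k point I; exists x.
have FE k A : F k A -> exists x r, 0 < r /\ A = cball x r.
  by move=> [x _ <-]; exists x, (2 * e k); rewrite mulr_gt0.
exists F; split; last by move=> k _; exact: FE.
split.
- move=> k _; apply/seteqP; split=> // y _.
  have [x Sx xy] := cov k y I.
  by exists (cball x (2 * e k)); [exists x|exact: ball_sub_cball].
- move=> k _ A /FE[x [r [_ ->]]].
  exact: subclosed_compact (closed_cball x r) cptX _.
- exists (Num.truncn (C * (C * 4 `^ s))) => k _ y.
  pose T := [fset x in S k | x \in cball y (2 * e k)]%fset.
  have TE : [set A | F k A /\ A y] `<=`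
      (fun x => cball x (2 * e k)) @` [set` T].
    move=> _ [[x Sx <-] xy]; exists x => //=; rewrite !inE /= Sx /=.
    by apply/asboolP; rewrite /cball /= metric_sym.
  apply: card_le_trans (subset_card_le TE) _.
  (* Distinct centres may give the same closed ball, so counting centres only bounds the
     multiplicity from above. *)
  apply: card_le_trans (card_image_le _ _) _.
  have [_ tS] := pS k.
  (* Taking [T] as the ambient set of the packing records that every centre is within [2 * e k] of
     [y]; the packed balls then stay within [3 * e k], inside [ball y (4 * e k)]. *)
  have pT : ball_packing (e k) [set` T] [set` T].
    split=> //; apply: sub_trivIset tS => x /=.
    by rewrite !inE => /andP[].
  have := @packing_le_measure (e k) _ T (ball y (4 * e k)) _ pT.
  move=> /(_ _ (measurable_ball _ _)).
  rewrite e0/=; have ek := e8 k; have ek0 := e0 k.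
  move=> /(_ ltac:(lra)) h.
  have {}h : (#|` T|%fset <= Num.truncn (C * (C * 4 `^ s)))%N.
    have /andP[_ hb] := reg y (4 * e k) ltac:(lra).
    have p0 : 0 < e k `^ s by exact: powR_gt0.
    rewrite truncn_ge_nat; last by rewrite !mulr_ge0 ?powR_ge0// ltW.
    have: ((#|` T|%fset%:R * (C^-1 * e k `^ s))%:E <=
        (C * (4 * e k) `^ s)%:E)%E.
      apply: le_trans hb; apply: h => x.
      rewrite /= !inE /= => /andP[_ /asboolP]; rewrite /cball /= => yx z.
      by rewrite !ballEmdist /= => xz; have := metric_triangle y x z; lra.
    rewrite lee_fin powRM//; last exact: ltW.
    by rewrite !mulrA ler_pM2r// ler_pdivrMr// => /le_trans; apply; lra.
  have /card_eq_fsetP/card_le_eql-> : #|` T|%fset = #|` T|%fset by [].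
  by rewrite card_le_II.
- have [m mE] := choice (fun k => finite_is_max _ _ (S k)
    (diam \o (fun x => cball x (2 * e k))) (Sne k)).
  exists m; split=> [k _|]; first by rewrite /F image_comp.
  (* The diameters are at most [2 * (2 * e k)], which is compared with the harmonic sequence. *)
  have le4 k : (0 <= m k <= (4 * k.+1%:R^-1)%:E)%E.
    have [[x _ <-] _] := mE k; rewrite /= diam_ge0/=.
    apply: le_trans (diam_cball _ _ _) _; first by rewrite mulr_ge0 ?ltW.
    rewrite lee_fin mulrA -natrM ler_pM2l//.
    rewrite /e lef_pV2 ?posrE ?ltr0n ?addn_gt0 ?orbT//.
    by rewrite ler_nat addnS ltnS leq_addr.
  apply: (@squeeze_cvge _ _ _ _ (fun=> 0%E) _ _ (nearW _ le4)).
    exact: cvg_cst.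
  apply: cvg_EFin; first exact: nearW.
  rewrite -[X in _ --> X](mulr0 4).
  by apply: cvgM; [exact: cvg_cst|exact: cvg_harmonic].
Qed.

Lemma regular_box_counting : box_counting_measure mu.
Proof.
split; first exact: regular_finite.
exists s; split; first exact: regular_box_dim.
have [F [cF FE]] := regular_covering.
exists F; split=> //; exists (C * 2 `^ s + 2 * C); split.
  by rewrite addr_gt0 ?mulr_gt0// powR_gt0.
by move=> k k1 A /FE -/(_ k1) [x [r [r0 ->]]]; exact: cball_box_counting.
Qed.

End Regular.

Theorem theorem1p1 (R : realType) (X : pmetricType R)
    (mu : {measure set (borel_space X) -> \bar R}) (s : R)
    (cptX : compact [set: X]) (dblX : doubling X)
    (regmu : ahlfors_regular mu s) :
  box_counting_measure mu.
Proof.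
by have [C [C0 reg]] := regmu; exact: regular_box_counting reg cptX.
Qed.
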